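(* Let $\mathcal{X}$ be a separable metric space and suppose $(X,X')$ is an exchangeable pair of $\mathcal{X}$-valued random variables. Suppose $f:\mathcal{X}\to\mathbb{R}$ and $F:\mathcal{X}\times\mathcal{X}\to\mathbb{R}$ are square-integrable functions such that $F$ is antisymmetric (i.e. $F(X,X')=-F(X',X)$ a.s.), and $\mathbb{E}(F(X,X')\mid X)=f(X)$ a.s. Let $$\Delta(X):=\frac12\,\mathbb{E}\left(\left|(f(X)-f(X'))F(X,X')\right|\,\middle|\,X\right).$$ Then $\mathbb{E}(f(X))=0$, and the following hold: (i) If $\mathbb{E}(\Delta(X))<\infty$, then $\mathrm{Var}(f(X))=\frac12\mathbb{E}\left((f(X)-f(X'))F(X,X')\right)$. (ii) Assume that $\mathbb{E}\left(e^{\theta f(X)}|F(X,X')|\right)<\infty$ for all $\theta\in\mathbb{R}$. If there exist nonnegative constants $B$ and $C$ such that $\Delta(X)\le Bf(X)+C$ almost surely, then for any $t\ge 0$, $$\mathbb{P}\{f(X)\ge t\}\le\exp\left(-\frac{t^2}{2C+2Bt}\right)\quad\text{and}\quad\mathbb{P}\{f(X)\le -t\}\le\exp\left(-\frac{t^2}{2C}\right).$$ (iii) For any positive integer $k$, $$\mathbb{E}\left(f(X)^{2k}\right)\le(2k-1)^k\,\mathbb{E}\left(\Delta(X)^k\right).$$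
   Context: A pair $(X,X')$ is exchangeable if $(X,X')$ and $(X',X)$ have the same joint distribution. Square-integrability of $f$ and $F$ means that $f$ and $F$ are measurable with $\mathbb{E}(f(X)^2)<\infty$ and $\mathbb{E}(F(X,X')^2)<\infty$. *)

(* Defs.v *)
From HB Require Import structures.
From mathcomp Require Import all_boot all_order all_algebra.
From mathcomp Require Import all_classical all_reals all_analysis.
From mathcomp Require Import measurable_realfun.

Set Implicit Arguments.
Unset Strict Implicit.
Unset Printing Implicit Defensive.

Import Order.TTheory GRing.Theory Num.Theory.
Import numFieldNormedType.Exports.

Local Open Scope classical_set_scope.
Local Open Scope ring_scope.

(* The library's sigma-algebras live on pointed types, hence the base point,
   which is harmless: a space carrying a random variable is not empty. *)
#[short(type="pmetricType")]
HB.structure Definition PointedMetric (K : numDomainType) :=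
  { M of Metric K M & Pointed M }.

Definition separable_space (T : topologicalType) : Prop :=
  exists2 S : set T, countable S & dense S.

(* The product sigma-algebra on [borel T * borel T] coincides with the Borel
   sigma-algebra of the product space when [T] is separable metric. *)
Notation borel T := (g_sigma_algebraType (@open T)).

Section random_elements.
Context {d d' : measure_display} {Omega : measurableType d}
  {S : measurableType d'} {R : realType} (P : probability Omega R).
Local Open Scope ereal_scope.

Definition exchangeable (X X' : Omega -> S) : Prop :=
  forall A : set (S * S), measurable A ->
    pushforward P (fun w => (X w, X' w)) A =
    pushforward P (fun w => (X' w, X w)) A.

Definition square_integrable (Y : Omega -> S) (g : S -> R) : Prop :=
  measurable_fun setT g /\ 'E_P[fun w => (g (Y w) ^+ 2)%R] < +oo.

(* [g \o X] is a version of the conditional expectation of [Y] given [X]. It is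
   to be used with [Y] measurable and either integrable or nonnegative; then
   [g \o X] is determined up to a null set, and it is automatically integrable,
   respectively nonnegative almost surely. The sets [X @^-1` A] are exactly the
   members of the sigma-algebra generated by [X]. *)
Definition is_condexp (X : Omega -> S) (Y : Omega -> \bar R)
    (g : S -> \bar R) : Prop :=
  measurable_fun setT g /\
  forall A : set S, measurable A ->
    \int[P]_(w in X @^-1` A) g (X w) = \int[P]_(w in X @^-1` A) Y w.

End random_elements.

(* Main.v *)
Require Import Defs.
From HB Require Import structures.
From mathcomp Require Import all_boot all_order all_algebra.
From mathcomp Require Import all_classical all_reals all_analysis.
From mathcomp Require Import measurable_realfun ring lra.

Set Implicit Arguments.
Unset Strict Implicit.
Unset Printing Implicit Defensive.

Import Order.TTheory GRing.Theory Num.Theory.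
Import numFieldNormedType.Exports.

Local Open Scope classical_set_scope.
Local Open Scope ring_scope.

(**
  Conditioning, exchangeability and antisymmetry give, for bounded h,
     2 E[h(X) f(X)] = E[(h(X) - h(X')) F(X, X')].
  Hence, if |h x - h y| <= (H x + H y) |f x - f y|, then
     E[h(X) f(X)] <= 2 E[H(X) Delta(X)].
  Everything but the variance formula follows from this one inequality, and
  only bounded h and H are needed provided that f is truncated first.

  - Tails: with g = min(f, t), h = e^(s g), H = (s / 2) e^(s g) and
    m(s) = E e^(s g), the inequality gives
       (1 - B s) E[f e^(s g)] <= s C m(s).
    By convexity m(y) - m(x) <= (y - x) E[f e^(y g)], and a discrete Gronwall
    argument bounds m without differentiating it. As {f >= t} = {g >= t}, the
    truncation does not affect the Chernoff bound. The lower tail is the same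
    statement for -f, and C = 0 is a limit case.
  - Moments: with g = f clipped to [-M, M], h = g^(2k-1) and
    H = ((2k-1) / 2) g^(2k-2), the inequality gives
       E g^(2k) <= (2k-1) E[g^(2k-2) Delta];
    Young's inequality then absorbs g^(2k) on the left, and M -> +oo.
*)

(** * Elementary inequalities for powers and exponentials, and a Gronwall bound *)

Section real_inequalities.
Context {R : realType}.
Implicit Types (a b s x y : R) (n k : nat).

(** Young's inequality with exponents [(n+1)/n] and [n+1]. Inductive step: the case [n] multiplied
    by [s], added to [(n+1) a^n (a - s)^2 >= 0], is the case [n+1]. *)
Lemma young_exprn n a s : 0 <= a -> 0 <= s ->
  n.+1%:R * (a ^+ n * s) <= n%:R * a ^+ n.+1 + s ^+ n.+1.
Proof.
move=> a0 s0; elim: n => [|n ih]; first by rewrite expr0 mul0r !mul1r add0r.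
have := ler_wpM2r s0 ih.
have : 0 <= n.+1%:R * (a ^+ n * (a - s) ^+ 2).
  by apply: mulr_ge0 => //; apply: mulr_ge0; [exact: exprn_ge0|exact: sqr_ge0].
rewrite -!natr1 !exprS expr0; lra.
Qed.

(** The difference of the two sides is [(a^(n-k) - b^(n-k)) (a^k - b^k)], whose factors have the
    same sign. *)
Lemma rearrangement_exprn n k a b : 0 <= a -> 0 <= b -> (k <= n)%N ->
  a ^+ (n - k) * b ^+ k + a ^+ k * b ^+ (n - k) <= a ^+ n + b ^+ n.
Proof.
move=> a0 b0 kn.
have : 0 <= (a ^+ (n - k) - b ^+ (n - k)) * (a ^+ k - b ^+ k).
  have [ab|/ltW ba] := leP a b.
    by apply: mulr_le0; rewrite subr_le0 lerXn2r.
  by apply: mulr_ge0; rewrite subr_ge0 lerXn2r.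
have split_exp (c : R) : c ^+ n = c ^+ (n - k) * c ^+ k by rewrite -exprD subnK.
rewrite (split_exp a) (split_exp b); lra.
Qed.

Lemma ler_dist_exprn n x y :
  `|x ^+ n.+1 - y ^+ n.+1| <=
  n.+1%:R / 2 * (`|x| ^+ n + `|y| ^+ n) * `|x - y|.
Proof.
rewrite subrXX normrM mulrC ler_wpM2r//.
apply: (le_trans (ler_norm_sum _ _ _)).
under eq_bigr do rewrite normrM !normrX.
set u := `|x|; set v := `|y|.
(* Reversing the index pairs each term with its mirror image; each pair is at most [u^n + v^n],
   which produces the factor 1/2. *)
have rev : \sum_(i < n.+1) u ^+ (n - i) * v ^+ i =
           \sum_(i < n.+1) u ^+ i * v ^+ (n - i).
  rewrite (reindex_inj rev_ord_inj); apply: eq_bigr => i _ /=.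
  by rewrite subSS subKn // -ltnS.
have : \sum_(i < n.+1) (u ^+ (n - i) * v ^+ i + u ^+ i * v ^+ (n - i)) <=
       \sum_(i < n.+1) (u ^+ n + v ^+ n).
  apply: ler_sum => i _; apply: rearrangement_exprn; rewrite ?normr_ge0//.
  by rewrite -ltnS.
rewrite big_split/= -rev sumr_const card_ord -[_ *+ _]mulr_natl; lra.
Qed.

(** Equivalent to [expR x - 1 <= x (1 + expR x) / 2]: the trapezoidal rule overestimates the
    integral of the convex function [expR]. *)
Lemma expR_le_trapezoid x : 0 <= x -> (2 - x) * expR x <= 2 + x.
Proof.
move=> x0.
pose h : R -> R := fun u => 2 + u - (2 - u) * expR u.
suff : h 0 <= h x by rewrite /h subr0 addr0 expR0 mulr1 subrr subr_ge0.
have dh (u : R) : is_derive u (1 : R) h (1 - (1 - u) * expR u).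
  apply: is_derive_eq; rewrite /GRing.scale/=; ring.
have hh (u : R) : derivable h u (1 : R) by have [] := dh u.
apply: (@ger0_derive1_le_cc _ h 0 x) => //.
- move=> u _; rewrite derive1E (@derive_val _ _ _ _ _ _ _ (dh u)) subr_ge0.
  rewrite -ler_pdivlMr ?expR_gt0// mul1r -expRN.
  by have := expR_ge1Dx (- u).
- by apply: derivable_within_continuous => u _.
- by rewrite in_itv/= lexx.
- by rewrite in_itv/= lexx andbT.
Qed.

(* The factor 1/2, compared to the mean value theorem, is what yields the
   constants of the tail bounds. *)
Lemma ler_dist_expR x y :
  `|expR x - expR y| <= (expR x + expR y) / 2 * `|x - y|.
Proof.
wlog yx : x y / y <= x => [W|].
  have [/W//|/ltW/W] := leP y x.
  by rewrite distrC (distrC y) (addrC (expR y)).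
rewrite !ger0_norm ?subr_ge0 ?ler_expR//.
have := @expR_le_trapezoid (x - y); rewrite subr_ge0 => /(_ yx).
rewrite expRD expRN; have y0 := expR_gt0 y.
rewrite mulrA ler_pdivrMr//; lra.
Qed.

(* Telescoping over the mesh [j * (z / N)]: each step costs a factor
   [1 / (1 - u) <= expR (u / (1 - e))], where [u <= e = K z^2 / N]. *)
Lemma discrete_gronwall (phi : R -> R) (K z : R) : 0 <= K -> 0 <= z ->
  phi 0 <= 1 -> (forall x, 0 <= phi x) ->
  (forall x y, 0 <= x -> x <= y -> y <= z ->
     phi y - phi x <= (y - x) * (K * y * phi y)) ->
  phi z <= expR (K * z ^+ 2 / 2).
Proof.
move=> K0 z0 phi0 phi_ge0 step; rewrite leNgt; apply/negP => gt_phi.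
set a := K * z ^+ 2 / 2 in gt_phi.
have a0 : 0 <= a by apply: divr_ge0 => //; apply: mulr_ge0 => //; exact: sqr_ge0.
have phiz0 : 0 < phi z by apply: lt_trans gt_phi; exact: expR_gt0.
set b := ln (phi z).
have phiE : phi z = expR b by rewrite lnK.
have ab : a < b by rewrite -ltr_expR -phiE.
(* The first bound gives [e < 1], hence positive factors [1 - u]; the second gives
   [a (N + 1) < (N - 2 a) b], which contradicts [bound] at [j = N]. *)
have [N Na Nab] : exists2 N : nat, 2 * a < N%:R & (a + 2 * a * b) / (b - a) < N%:R.
  exists (Num.truncn (2 * a + (a + 2 * a * b) / (b - a))).+1;
    apply: (le_lt_trans _ (truncnS_gt _)).
  - rewrite lerDl divr_ge0 ?subr_ge0 ?(ltW ab)//; nra.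
  - by rewrite lerDr mulr_ge0.
have N0 : 0 < N%:R :> R by apply: le_lt_trans Na; rewrite mulr_ge0.
set d := z / N%:R; set e := 2 * a / N%:R.
have d0 : 0 <= d by rewrite divr_ge0// ltW.
have e1 : e < 1 by rewrite /e ltr_pdivrMr// mul1r.
have e1' : 0 < 1 - e by rewrite subr_gt0.
have Nd : N%:R * d = z by rewrite /d mulrCA divff ?mulr1// gt_eqF.
have KdN : K * d ^+ 2 * N%:R = e.
  by rewrite /e /a /d; field; rewrite gt_eqF.
(* The exponent is the sum of the losses [K d^2 i] over [1 <= i <= j], divided by [1 - e]. *)
have bound j : (j <= N)%N ->
    phi (j%:R * d) <= expR ((1 - e)^-1 * (K * d ^+ 2 * (j%:R * j.+1%:R / 2))).
  elim: j => [_|j ih jN]; first by rewrite !mul0r !mulr0 expR0.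
  set x := j%:R * d; set y := j.+1%:R * d; set u := K * d ^+ 2 * j.+1%:R.
  have u0 : 0 <= u by rewrite /u !mulr_ge0// ?exprn_ge0.
  have ue : u <= e by rewrite -KdN ler_wpM2l ?mulr_ge0 ?exprn_ge0// ler_nat.
  have xy : y - x = d by rewrite /y /x -natr1; ring.
  have x0 : 0 <= x by rewrite mulr_ge0.
  have lxy : x <= y by rewrite -subr_ge0 xy.
  have yz : y <= z by rewrite -Nd ler_wpM2r// ler_nat.
  have := step x y x0 lxy yz; rewrite xy => stepxy.
  have {}stepxy : (1 - u) * phi y <= phi x.
    have -> : (1 - u) * phi y = phi y - d * (K * y * phi y).
      by rewrite /u /y; ring.
    lra.
  (* Since [expR v >= 1 + v], it suffices that [(1 - u) (1 - e + u) = (1 - e) + u (e - u)] is at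
     least [1 - e]. *)
  have expu : 1 <= (1 - u) * expR ((1 - e)^-1 * u).
    have : (1 - u) * (1 + (1 - e)^-1 * u) <= (1 - u) * expR ((1 - e)^-1 * u).
      by rewrite ler_wpM2l ?expR_ge1Dx// subr_ge0 (le_trans ue (ltW e1)).
    apply: le_trans.
    rewrite -(ler_pM2l e1') mulrCA mulrDr mulrA divff ?gt_eqF// !mulr1 mul1r.
    nra.
  have -> : (1 - e)^-1 * (K * d ^+ 2 * (j.+1%:R * j.+2%:R / 2)) =
      (1 - e)^-1 * (K * d ^+ 2 * (j%:R * j.+1%:R / 2)) + (1 - e)^-1 * u.
    by rewrite /u -!natr1; field; rewrite gt_eqF.
  rewrite expRD; apply: (@le_trans _ _ (phi x * expR ((1 - e)^-1 * u))).
    rewrite (le_trans (ler_peMr (phi_ge0 y) expu))// mulrCA mulrA.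
    by rewrite ler_wpM2r ?expR_ge0.
  by rewrite ler_wpM2r ?expR_ge0// ih// ltnW.
have := bound N (leqnn N); rewrite Nd phiE ler_expR.
have -> : K * d ^+ 2 * (N%:R * N.+1%:R / 2) = e * N.+1%:R / 2.
  by rewrite -KdN; field.
rewrite ler_pdivlMl//.
rewrite -(ler_pM2r N0).
have -> : (1 - e) * b * N%:R = (N%:R - 2 * a) * b.
  by rewrite /e; field; rewrite gt_eqF.
have -> : e * N.+1%:R / 2 * N%:R = a * (N%:R + 1).
  by rewrite /e -natr1; field; rewrite gt_eqF.
move: Nab; rewrite ltr_pdivrMr ?subr_gt0//; lra.
Qed.

(** For [p > 0], logarithms turn the hypothesis into [t^2 <= - ln p * (e + D)], where [e] may tend
    to 0. This serves tail bounds whose denominator may vanish. *)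
Lemma ler_expR_div_perturb (p t D : R) : 0 <= p -> 0 <= t -> 0 <= D -> p <= 1 ->
  (forall e, 0 < e -> p <= expR (- (t ^+ 2 / (e + D)))) ->
  (p%:E <= expeR (- ((t ^+ 2)%:E / D%:E)))%E.
Proof.
move=> p0 t0 D0 p1 H.
have [->|tn0] := eqVneq t 0.
  by rewrite expr0n/= mul0e oppe0 expeR0 lee_fin.
have t20 : 0 < t ^+ 2 by rewrite exprn_gt0// lt0r tn0.
have [->|pn0] := eqVneq p 0; first exact: expeR_ge0.
have {p0 pn0}p0 : 0 < p by rewrite lt0r pn0.
have L0 : 0 <= - ln p by rewrite oppr_ge0 ln_le0.
have key : t ^+ 2 <= - ln p * D.
  (* This choice gives [- ln p * e <= r]; the summand 1 keeps the denominator positive when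
     [p = 1]. *)
  apply/ler_addgt0Pr => r r0; pose e := r / (1 - ln p).
  have e0 : 0 < e by rewrite divr_gt0// ltr_wpDr.
  have := H e e0; rewrite -{1}(lnK p0) ler_expR lerNr.
  rewrite ler_pdivrMr ?ltr_wpDr// => /le_trans; apply.
  rewrite mulrDr addrC lerD2l /e mulrA ler_pdivrMr ?ltr_wpDr//.
  by rewrite mulrC ler_wpM2l ?ltW//; lra.
(* For [D = 0], [key] would force [t = 0]; so the extended quotient is an ordinary one here. *)
have Dn0 : D != 0 by apply: contra_leN key => /eqP ->; rewrite mulr0.
have {D0 Dn0}D0 : 0 < D by rewrite lt0r Dn0.
rewrite inver gt_eqF//= lee_fin -{1}(lnK p0) ler_expR lerNr.
by rewrite ler_pdivrMr.
Qed.
End real_inequalities.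

(** * Integrability and almost sure comparison of integrals *)

Section integrability.
Context {d} {Omega : measurableType d} {R : realType} (P : probability Omega R).
Local Notation L1 Y := (P.-integrable setT (EFin \o Y)).
Local Notation E Y := (\int[P]_w Y w).

Lemma integrable_bounded_mul (h Y : Omega -> R) c : measurable_fun setT h ->
  (forall w, `|h w| <= c) -> L1 Y -> L1 (fun w => h w * Y w).
Proof.
move=> mh hc iY.
have mY : measurable_fun setT Y by move/measurable_int/measurable_EFinP : iY.
apply: le_integrable (integrableZl measurableT c iY) => //.
  by apply/measurable_EFinP; exact: measurable_funM.
move=> w _ /=; rewrite lee_fin !normrM ler_wpM2r//.
by rewrite (le_trans (hc w))// ler_norm.
Qed.

Lemma integrable_dominated (Y Z : Omega -> R) : measurable_fun setT Y ->
  (forall w, `|Y w| <= Z w) -> L1 Z -> L1 Y.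
Proof.
move=> mY YZ; apply: le_integrable => //; first exact/measurable_EFinP.
by move=> w _ /=; rewrite lee_fin (le_trans (YZ w))// ler_norm.
Qed.

Lemma integrableD_EFin (Y Z : Omega -> R) :
  L1 Y -> L1 Z -> L1 (fun w => Y w + Z w).
Proof. by move=> iY iZ; have := integrableD measurableT iY iZ. Qed.

Lemma integrable_cst (c : R) : L1 (fun=> c).
Proof. exact: finite_measure_integrable_cst. Qed.

Lemma integrable_mul_sqr (Y Z : Omega -> R) :
  measurable_fun setT Y -> measurable_fun setT Z ->
  L1 (fun w => Y w ^+ 2) -> L1 (fun w => Z w ^+ 2) -> L1 (fun w => Y w * Z w).
Proof.
move=> mY mZ iY iZ.
apply: (integrable_dominated _ _ (integrableD_EFin iY iZ)).
  exact: measurable_funM.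
move=> w; rewrite normrM.
have := sqr_ge0 (`|Y w| - `|Z w|); rewrite -(real_normK (num_real (Y w))).
rewrite -(real_normK (num_real (Z w))).
have := sqr_ge0 `|Y w|; have := sqr_ge0 `|Z w|; lra.
Qed.

Lemma integrable_of_sqr (Y : Omega -> R) : measurable_fun setT Y ->
  L1 (fun w => Y w ^+ 2) -> L1 Y.
Proof.
move=> mY iY.
have := @integrable_mul_sqr Y (cst 1) mY (measurable_cst _) iY.
have -> : (fun w => Y w * cst 1 w) = Y by apply/funext => w; rewrite mulr1.
by apply; rewrite /= expr1n; exact: integrable_cst.
Qed.

Lemma integrable_expectation_sqr (Y : Omega -> R) : measurable_fun setT Y ->
  ('E_P[fun w => (Y w ^+ 2)%R] < +oo)%E -> L1 (fun w => Y w ^+ 2).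
Proof.
move=> mY; rewrite unlock => Yoo; apply/integrableP; split.
  by apply/measurable_EFinP; exact: measurable_funX.
by under eq_integral do rewrite /= ger0_norm ?sqr_ge0//.
Qed.

Lemma ae_eq_Rintegral (Y Z : Omega -> R) : measurable_fun setT Y ->
  measurable_fun setT Z -> {ae P, forall w, Y w = Z w} -> E Y = E Z.
Proof.
move=> mY mZ YZ; congr fine; apply: ae_eq_integral => //.
- exact/measurable_EFinP.
- exact/measurable_EFinP.
- by apply: filterS YZ => w -> _.
Qed.

Lemma ae_le_Rintegral (Y Z : Omega -> R) : L1 Y -> L1 Z ->
  {ae P, forall w, Y w <= Z w} -> E Y <= E Z.
Proof.
move=> iY iZ YZ.
have mY : measurable_fun setT Y by move/measurable_int/measurable_EFinP : iY.
have mZ : measurable_fun setT Z by move/measurable_int/measurable_EFinP : iZ.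
(* The minimum agrees with [Y] almost surely and lies below [Z] everywhere, so pointwise
   monotonicity applies to it. *)
have mYZ : measurable_fun setT (fun w => Num.min (Y w) (Z w)).
  exact: measurable_minr.
rewrite (@ae_eq_Rintegral Y (fun w => Num.min (Y w) (Z w)))//; last first.
  by apply: filterS YZ => w YZ; rewrite min_l.
apply: le_Rintegral => //; last by move=> w _; rewrite ge_min lexx orbT.
apply: (integrable_dominated mYZ _
  (integrableD_EFin (integrable_norm iY) (integrable_norm iZ))).
move=> w /=; rewrite /Num.min; case: ifPn => _; first by rewrite lerDl.
by rewrite lerDr.
Qed.

End integrability.

(** * Swapping the two variables of an exchangeable pair *)

Section exchangeable_pair.
Context {d d'} {Omega : measurableType d} {S : measurableType d'}
  {R : realType} (P : probability Omega R) (X X' : {mfun Omega >-> S}).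
Local Notation L1 Y := (P.-integrable setT (EFin \o Y)).
Local Notation E Y := (\int[P]_w Y w).

(** Both sides integrate [g] against the law of the pair, in its two orders; these laws agree on
    measurable sets. *)
Lemma ge0_exchangeable (g : S * S -> \bar R) : exchangeable P X X' ->
  measurable_fun setT g -> (forall z, 0 <= g z)%E ->
  (\int[P]_w g (X w, X' w) = \int[P]_w g (X' w, X w))%E.
Proof.
move=> exch mg g0.
have mZ : measurable_fun setT (fun w => (X w, X' w)) by exact: measurable_fun_pair.
have mZ' : measurable_fun setT (fun w => (X' w, X w)) by exact: measurable_fun_pair.
have := ge0_integral_pushforward mZ P measurableT mg (fun y _ => g0 y).
have := ge0_integral_pushforward mZ' P measurableT mg (fun y _ => g0 y).
rewrite !preimage_setT => <- <-.
apply: eq_measure_integral => A mA _; exact: exch.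
Qed.

Lemma exchangeable_integrable (g : S * S -> R) : exchangeable P X X' ->
  measurable_fun setT g ->
  L1 (fun w => g (X w, X' w)) -> L1 (fun w => g (X' w, X w)).
Proof.
move=> exch mg /integrableP[_ goo]; apply/integrableP; split.
  apply/measurable_EFinP; apply: (measurableT_comp mg).
  exact: measurable_fun_pair.
rewrite -(@ge0_exchangeable (fun z => `|g z|%:E))//.
by apply/measurable_EFinP; exact: measurableT_comp.
Qed.

Lemma exchangeable_Rintegral (g : S * S -> R) : exchangeable P X X' ->
  measurable_fun setT g -> L1 (fun w => g (X w, X' w)) ->
  E (fun w => g (X w, X' w)) = E (fun w => g (X' w, X w)).
Proof.
move=> exch mg ig; have ig' := exchangeable_integrable exch mg ig.
have mZ : measurable_fun setT (fun w => (X w, X' w)) by exact: measurable_fun_pair.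
have mZ' : measurable_fun setT (fun w => (X' w, X w)) by exact: measurable_fun_pair.
have mg' : measurable_fun setT (EFin \o g) by exact/measurable_EFinP.
congr fine.
have := integral_pushforward mZ mg' ig measurableT.
have := integral_pushforward mZ' mg' ig' measurableT.
rewrite !preimage_setT /comp/= => <- <-.
apply: eq_measure_integral => A mA _; exact: exch.
Qed.

End exchangeable_pair.

(** * Taking functions of [X] out of a conditional expectation *)

Section orthogonality.
Context {d d'} {Omega : measurableType d} {S : measurableType d'}
  {R : realType} (P : probability Omega R) (X : {mfun Omega >-> S}).
Local Notation L1 Y := (P.-integrable setT (EFin \o Y)).
Local Notation E Y := (\int[P]_w Y w).
Variable Z : Omega -> R.
Hypothesis iZ : L1 Z.
Hypothesis Z0 : forall A, measurable A -> (\int[P]_(w in X @^-1` A) (Z w)%:E = 0)%E.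

Let mZ : measurable_fun setT Z.
Proof. by move/measurable_int/measurable_EFinP : iZ. Qed.

Import HBNNSimple.

Let orthogonal_indic A r : measurable A ->
  (\int[P]_w (r * \1_A (X w) * Z w)%:E = 0)%E.
Proof.
move=> mA.
have mXA : measurable (X @^-1` A) by exact: measurable_funPTI.
under eq_integral do rewrite -mulrA EFinM.
rewrite integralZl//; last first.
  by apply: (@integrable_bounded_mul _ _ _ P _ _ 1) => //;
   [exact: measurableT_comp|move=> w; rewrite indicE; case: (_ \in _)];
   rewrite ?normr1 ?normr0.
rewrite -[RHS](mule0 r%:E) -(Z0 mA) [in RHS]integral_mkcond.
congr (_ * _)%E; apply: eq_integral => w _; rewrite patchE indicE.
have -> : (w \in X @^-1` A) = (X w \in A) by apply/idP/idP; rewrite !inE.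
by case: (X w \in A); rewrite ?mul1r ?mul0r.
Qed.

Let orthogonal_nnsfun (h : {nnsfun S >-> R}) : (\int[P]_w (h (X w) * Z w)%:E = 0)%E.
Proof.
transitivity (\int[P]_w (\sum_(r <- finmap.enum_fset (fset_set (range h)))
    (r * \1_(h @^-1` [set r]) (X w) * Z w)%:E))%E.
  apply: eq_integral => w _; rewrite sumEFin; congr EFin.
  by rewrite -mulr_suml; congr (_ * _); rewrite {1}fimfunE fsbig_finite.
rewrite integral_sum//; first by rewrite big1// => r _; exact: orthogonal_indic.
move=> r.
apply: (@integrable_bounded_mul _ _ _ P _ _ `|r|) => //.
  by apply: measurable_funM => //; apply: measurableT_comp.
move=> w; rewrite indicE; case: (_ \in _); rewrite ?mulr1 ?mulr0 ?normr0//.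
Qed.

Let orthogonal_ge0 (h : S -> R) : measurable_fun setT h -> (forall x, 0 <= h x) ->
  L1 (fun w => h (X w) * Z w) -> (\int[P]_w (h (X w) * Z w)%:E = 0)%E.
Proof.
move=> mh h0 ihZ.
have mEh : measurable_fun setT (EFin \o h) by exact/measurable_EFinP.
pose h_ := nnsfun_approx measurableT mEh.
have h_cvg x : h_ ^~ x @ \oo --> h x.
  have : (EFin \o (h_ ^~ x)) n @[n --> \oo] --> (h x)%:E.
    by apply: (cvg_nnsfun_approx measurableT mEh) => // y _; rewrite lee_fin.
  by move/fine_cvg; apply.
have h_le n x : h_ n x <= h x.
  have nd : nondecreasing_seq (h_ ^~ x).
    by move=> m p mp; have /lefP := nd_nnsfun_approx measurableT mEh mp; exact.
  have <- : limn (h_ ^~ x) = h x by apply/cvg_lim.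
  by apply: nondecreasing_cvgn_le => //; apply/cvg_ex; exists (h x).
(* The approximations satisfy [0 <= h_ n <= h], so the absolute value of [h (X) Z], integrable by
   [ihZ], dominates. *)
have [] := @dominated_convergence _ _ _ P setT measurableT
  (fun n w => (h_ n (X w) * Z w)%:E) (fun w => (h (X w) * Z w)%:E)
  (fun w => `|h (X w) * Z w|%:E).
- move=> n; apply/measurable_EFinP; apply: measurable_funM => //.
  exact: measurableT_comp.
- apply/measurable_EFinP; apply: measurable_funM => //.
  exact: measurableT_comp.
- apply: aeW => w _; apply: cvg_EFin; first exact: nearW.
  by apply: cvgMl; exact: h_cvg.
- by apply: integrable_abse ihZ.
- apply: aeW => w n _ /=; rewrite lee_fin !normrM ler_wpM2r//.
  by rewrite !ger0_norm.
move=> _ _ /cvg_lim <-//; rewrite [X in limn X](_ : _ = cst 0%E) ?lim_cst//.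
by apply/funext => n; exact: orthogonal_nnsfun.
Qed.

(** The class of admissible [h] grows from indicators ([Z0]) through simple functions and their
    limits to differences of nonnegative functions. It is used with [Z] the difference between a
    variable and its conditional expectation given [X]. *)
Lemma Rintegral_orthogonal (h : S -> R) : measurable_fun setT h ->
  L1 (fun w => h (X w) * Z w) -> E (fun w => h (X w) * Z w) = 0.
Proof.
move=> mh ihZ.
have mhX : measurable_fun setT (fun w => h (X w)) by exact: measurableT_comp.
have pos (k : S -> R) : measurable_fun setT k -> (forall x, 0 <= k x) ->
    (forall x, k x <= `|h x|) ->
    L1 (fun w => k (X w) * Z w) /\ E (fun w => k (X w) * Z w) = 0.
  move=> mk k0 kh.
  have ik : L1 (fun w => k (X w) * Z w).
    apply: (integrable_dominated _ _ (integrable_norm ihZ)).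
      by apply: measurable_funM => //; exact: measurableT_comp.
    by move=> w /=; rewrite !normrM ler_wpM2r// ger0_norm.
  by split=> //; rewrite /Rintegral orthogonal_ge0.
have [ip p0] : _ /\ _ := pos (fun x => Num.max (h x) 0) ltac:(exact: measurable_maxr)
  ltac:(by move=> x; rewrite le_max lexx orbT)
  ltac:(by move=> x; rewrite ge_max ler_norm normr_ge0).
have [im m0] : _ /\ _ := pos (fun x => Num.max (- h x) 0)
  ltac:(by apply: measurable_maxr => //; exact: measurable_funN)
  ltac:(by move=> x; rewrite le_max lexx orbT)
  ltac:(by move=> x; rewrite ge_max -normrN ler_norm normr_ge0).
transitivity (E (fun w => Num.max (h (X w)) 0 * Z w - Num.max (- h (X w)) 0 * Z w)).
  apply: eq_Rintegral => w _ /=; rewrite -mulrBl; congr (_ * _).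
  by set u := h (X w); case: (lerP u 0) => u0; case: (lerP (- u) 0) => u1; lra.
by rewrite RintegralB// p0 m0 subrr.
Qed.

End orthogonality.

(** * The exchangeable pair identity and the inequality derived from it *)

Section stein_pair.
Context {d d'} {Omega : measurableType d} {S : measurableType d'}
  {R : realType} (P : probability Omega R) (X X' : {mfun Omega >-> S}).
Local Notation L1 Y := (P.-integrable setT (EFin \o Y)).
Local Notation E Y := (\int[P]_w Y w).

Variables (f D : S -> R) (F : S * S -> R).
Hypotheses (exch : exchangeable P X X')
  (mf : measurable_fun setT f) (mF : measurable_fun setT F)
  (if2 : L1 (fun w => f (X w) ^+ 2))
  (iF2 : L1 (fun w => F (X w, X' w) ^+ 2))
  (anti : {ae P, forall w, F (X w, X' w) = - F (X' w, X w)})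
  (condf : forall A, measurable A ->
    (\int[P]_(w in X @^-1` A) (f (X w))%:E =
     \int[P]_(w in X @^-1` A) (F (X w, X' w))%:E)%E).

Let mfX : measurable_fun setT (fun w => f (X w)).
Proof. exact: measurableT_comp. Qed.

Let mfX' : measurable_fun setT (fun w => f (X' w)).
Proof. exact: measurableT_comp. Qed.

Let mXX' : measurable_fun setT (fun w => (X w, X' w)).
Proof. exact: measurable_fun_pair. Qed.

Let mX'X : measurable_fun setT (fun w => (X' w, X w)).
Proof. exact: measurable_fun_pair. Qed.

Let mFX : measurable_fun setT (fun w => F (X w, X' w)).
Proof. exact: measurableT_comp. Qed.

Let mFX' : measurable_fun setT (fun w => F (X' w, X w)).
Proof. exact: measurableT_comp. Qed.

Let if1 : L1 (fun w => f (X w)).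
Proof. exact: integrable_of_sqr. Qed.

Let iF : L1 (fun w => F (X w, X' w)).
Proof. exact: integrable_of_sqr. Qed.

Lemma integrable_sqr_swap : L1 (fun w => f (X' w) ^+ 2).
Proof.
apply: (exchangeable_integrable (g := fun z => f z.1 ^+ 2) exch) => //.
apply: measurable_funX; apply: measurableT_comp => //; exact: measurable_fst.
Qed.

Lemma integrable_stein_product :
  L1 (fun w => (f (X w) - f (X' w)) * F (X w, X' w)).
Proof.
have i1 := integrable_mul_sqr mfX mFX if2 iF2.
have i2 := integrable_mul_sqr mfX' mFX integrable_sqr_swap iF2.
have -> : (fun w => (f (X w) - f (X' w)) * F (X w, X' w)) =
    (fun w => f (X w) * F (X w, X' w) - f (X' w) * F (X w, X' w)).
  by apply/funext => w; rewrite mulrBl.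
by have := integrableB measurableT i1 i2.
Qed.

Lemma stein_identity (h : S -> R) : measurable_fun setT h ->
  L1 (fun w => h (X w) * f (X w)) -> L1 (fun w => h (X w) * F (X w, X' w)) ->
  L1 (fun w => h (X' w) * F (X w, X' w)) ->
  2 * E (fun w => h (X w) * f (X w)) =
  E (fun w => (h (X w) - h (X' w)) * F (X w, X' w)).
Proof.
move=> mh ihf ihF ih'F.
have mhX : measurable_fun setT (fun w => h (X w)) by exact: measurableT_comp.
have mhX' : measurable_fun setT (fun w => h (X' w)) by exact: measurableT_comp.
(* Conditioning: by [condf], [f (X) - F (X, X')] is orthogonal to functions of [X]. *)
have hfF : E (fun w => h (X w) * f (X w)) = E (fun w => h (X w) * F (X w, X' w)).
  apply/eqP; rewrite -subr_eq0 -RintegralB//.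
  under eq_Rintegral do rewrite -mulrBr.
  apply/eqP; apply: (@Rintegral_orthogonal _ _ _ _ _ P X) => //.
  - by have := integrableB measurableT if1 iF.
  - move=> A mA.
    have mXA : measurable (X @^-1` A) by exact: measurable_funPTI.
    under eq_integral do rewrite EFinB.
    rewrite integralB ?condf ?subee//.
    + apply: integrable_fin_num => //; exact: integrableS iF.
    + exact: integrableS if1.
    + exact: integrableS iF.
  - have := integrableB measurableT ihf ihF; apply: eq_integrable => // w _ /=.
    by rewrite mulrBr.
(* Exchangeability leads to [h (X') F (X', X)], which antisymmetry turns into [- h (X') F (X, X')].
   Adding the two expressions yields [h (X) - h (X')]. *)
have swap : E (fun w => h (X w) * F (X w, X' w)) =
    E (fun w => - (h (X' w) * F (X w, X' w))).
  rewrite (@exchangeable_Rintegral _ _ _ _ _ P X X' (fun z => h z.1 * F z))//.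
    apply: ae_eq_Rintegral => /=.
    - exact: measurable_funM.
    - apply: measurable_funN; exact: measurable_funM.
    - by apply: filterS anti => w ->; rewrite mulrN opprK.
  by apply: measurable_funM => //; apply: measurableT_comp.
rewrite mulr_natl mulr2n {1}hfF hfF {2}swap -RintegralD//.
  by apply: eq_Rintegral => w _; rewrite mulrBl.
by have := integrableN ih'F.
Qed.

(** For [h = 1] the right side of [stein_identity] vanishes. *)
Lemma Rintegral_stein0 : E (fun w => f (X w)) = 0.
Proof.
have one_mul (Y : Omega -> R) : L1 Y -> L1 (fun w => 1 * Y w).
  by apply: eq_integrable => // w _ /=; rewrite mul1r.
have := @stein_identity (cst 1) (measurable_cst _)
  (one_mul _ if1) (one_mul _ iF) (one_mul _ iF).
have -> : E (fun w => cst 1 (X w) * f (X w)) = E (fun w => f (X w)).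
  by apply: eq_Rintegral => w _; rewrite mul1r.
have -> : E (fun w => (cst 1 (X w) - cst 1 (X' w)) * F (X w, X' w)) = 0.
  rewrite -[RHS](mul0r (fine (P setT))) -Rintegral_cst//.
  by apply: eq_Rintegral => w _; rewrite /= subrr mul0r.
lra.
Qed.

(** Case [h = f] of [stein_identity]; as the mean is 0, the left side is twice the variance. *)
Lemma stein_variance : 2 * E (fun w => f (X w) ^+ 2) =
  E (fun w => (f (X w) - f (X' w)) * F (X w, X' w)).
Proof.
rewrite -stein_identity//.
- exact: integrable_mul_sqr.
- by apply: integrable_mul_sqr => //; exact: integrable_sqr_swap.
Qed.

Hypotheses (iD : L1 (fun w => D (X w)))
  (condD : forall A, measurable A ->
    (\int[P]_(w in X @^-1` A) (D (X w))%:E =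
     \int[P]_(w in X @^-1` A)
       `|(f (X w) - f (X' w)) * F (X w, X' w)|%:E)%E).

(** The right side of [stein_identity] is at most the mean of [(H (X) + H (X')) W]. By antisymmetry
    [W] is almost surely symmetric in the pair, so both summands have the same mean, which
    conditioning turns into that of [H (X) D (X)]; the factor 2 cancels. *)
Lemma stein_bound (h H : S -> R) (c : R) :
  measurable_fun setT h -> measurable_fun setT H ->
  (forall x, `|h x| <= c) -> (forall x, `|H x| <= c) ->
  (forall x y, `|h x - h y| <= (H x + H y) * `|f x - f y|) ->
  E (fun w => h (X w) * f (X w)) <= E (fun w => H (X w) * D (X w)).
Proof.
move=> mh mH hc Hc hH.
have mcomp (k : S -> R) (Y : {mfun Omega >-> S}) : measurable_fun setT k ->
  measurable_fun setT (fun w => k (Y w)) by move=> mk; exact: measurableT_comp.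
pose W w := `|(f (X w) - f (X' w)) * F (X w, X' w)|.
have iW : L1 W by exact: integrable_norm integrable_stein_product.
have mW : measurable_fun setT W by move/measurable_int/measurable_EFinP : iW.
have ib (k : S -> R) (Y : {mfun Omega >-> S}) (Z : Omega -> R) :
    measurable_fun setT k -> (forall x, `|k x| <= c) -> L1 Z ->
    L1 (fun w => k (Y w) * Z w).
  by move=> mk kc iZ; apply: (integrable_bounded_mul (c := c)) => //; exact: mcomp.
have HWD : E (fun w => H (X w) * W w) = E (fun w => H (X w) * D (X w)).
  apply/eqP; rewrite -subr_eq0 -RintegralB//; [|exact: ib..].
  under eq_Rintegral do rewrite -mulrBr.
  have iWD : L1 (fun w => W w - D (X w)) by have := integrableB measurableT iW iD.
  apply/eqP; apply: (@Rintegral_orthogonal _ _ _ _ _ P X) => //; last exact: ib.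
  move=> A mA.
  have mXA : measurable (X @^-1` A) by exact: measurable_funPTI.
  under eq_integral do rewrite EFinB.
  rewrite integralB ?condD ?subee//.
  - apply: integrable_fin_num => //; exact: integrableS iW.
  - exact: integrableS iW.
  - exact: integrableS iD.
have HW' : E (fun w => H (X' w) * W w) = E (fun w => H (X w) * W w).
  pose g (z : S * S) := H z.1 * `|(f z.1 - f z.2) * F z|.
  have mg : measurable_fun setT g.
    apply: measurable_funM; first by apply: measurableT_comp.
    apply: measurableT_comp => //; apply: measurable_funM => //.
    by apply: measurable_funB; apply: measurableT_comp.
  have ig : L1 (fun w => g (X w, X' w)) by exact: ib.
  rewrite (exchangeable_Rintegral exch mg ig).
  apply: ae_eq_Rintegral.
  - by apply: measurable_funM => //; exact: mcomp.
  - exact: measurableT_comp.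
  - by apply: filterS anti => w Fw; rewrite /g/W/= Fw mulrN normrN !normrM distrC.
rewrite -(ler_pM2l (ltr0n R 2)) stein_identity//; [|exact: ib..].
rewrite -HWD mulr_natl mulr2n -{2}HW' -RintegralD//; [|exact: ib..].
apply: le_Rintegral => //.
- have := integrableB measurableT (ib h X _ mh hc iF) (ib h X' _ mh hc iF).
  by apply: eq_integrable => // w _ /=; rewrite mulrBl.
- by apply: integrableD_EFin; exact: ib.
- move=> w _; apply: le_trans (ler_norm _) _.
  rewrite -mulrDl /W !normrM mulrA ler_wpM2r//; exact: hH.
Qed.

End stein_pair.

(* [D] plays the role of [2 Delta(X)], i.e. of the conditional expectation before
   halving. *)
Definition stein_dominated {d} {Omega : measurableType d} {R : realType}
    (P : probability Omega R) (Y D : Omega -> R) : Prop :=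
  forall (phi psi : R -> R) (c : R),
    measurable_fun setT phi -> measurable_fun setT psi ->
    (forall u, `|phi u| <= c) -> (forall u, `|psi u| <= c) ->
    (forall u v, `|phi u - phi v| <= (psi u + psi v) * `|u - v|) ->
    \int[P]_w (phi (Y w) * Y w) <= \int[P]_w (psi (Y w) * D w).

(** Serves the lower tail: [- phi (- u)] and [psi (- u)] are again admissible test functions, with
    the same [D]. *)
Lemma stein_dominatedN {d} {Omega : measurableType d} {R : realType}
    (P : probability Omega R) (Y D : Omega -> R) :
  stein_dominated P Y D -> stein_dominated P (fun w => - Y w) D.
Proof.
move=> stein phi psi c mphi mpsi phic psic phipsi.
under eq_Rintegral do rewrite mulrN -mulNr.
apply: (stein (fun u => - phi (- u)) (fun u => psi (- u)) c).
- by apply: measurable_funN; exact: measurableT_comp.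
- exact: measurableT_comp.
- by move=> u; rewrite normrN.
- by [].
- move=> u v; have := phipsi (- u) (- v).
  by rewrite -!opprD !normrN.
Qed.

(** * Consequences of the inequality for one real random variable *)

Section stein_inequality.
Context {d} {Omega : measurableType d} {R : realType} (P : probability Omega R).
Local Notation L1 Y := (P.-integrable setT (EFin \o Y)).
Local Notation E Y := (\int[P]_w Y w).
Variables (Y D : Omega -> R).
Hypotheses (iY : L1 Y) (iD : L1 D) (D_ge0 : forall w, 0 <= D w).
Hypothesis stein : stein_dominated P Y D.

Let mY : measurable_fun setT Y.
Proof. by move/measurable_int/measurable_EFinP : iY. Qed.

Let ib (phi : R -> R) (c : R) (Z : Omega -> R) : measurable_fun setT phi ->
  (forall u, `|phi u| <= c) -> L1 Z -> L1 (fun w => phi (Y w) * Z w).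
Proof.
move=> mphi phic iZ; apply: (integrable_bounded_mul (c := c)) => //.
exact: measurableT_comp.
Qed.

Let measurable_superlevel t : measurable [set w | t <= Y w].
Proof.
rewrite (_ : [set w | _] = Y @^-1` `[t, +oo[%classic).
  by rewrite -[X in measurable X]setTI; exact: mY.
by apply/seteqP; split => w /=; rewrite in_itv/= andbT.
Qed.

(** * Exponential tail bounds *)

Section tail.
(** [b] is the slope in the bound on [D], [beta] the one in the exponent. The upper tail takes both
    equal to [B]; the lower tail concerns [- f] with [b = - B] and [beta = 0], whence its purely
    Gaussian bound. *)
Variables (b beta C t : R).
Hypotheses (EY0 : E Y = 0) (beta0 : 0 <= beta) (b_beta : b <= beta)
  (C0 : 0 < C) (t0 : 0 <= t)
  (D_le : {ae P, forall w, D w / 2 <= b * Y w + C}).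

Let trunc (u : R) : R := Num.min u t.
Let ex (s u : R) : R := expR (s * trunc u).
Let m s : R := E (fun w => ex s (Y w)).

Let trunc_le u : trunc u <= u. Proof. by rewrite ge_min lexx. Qed.

Let trunc_dist u v : `|trunc u - trunc v| <= `|u - v|.
Proof.
rewrite /trunc; case: (lerP u t) => ut; case: (lerP v t) => vt;
  rewrite ler_norml; have := ler_norm (u - v); have := ler_norm (v - u);
  rewrite (distrC v); move: ut vt; lra.
Qed.

Let m_trunc : measurable_fun setT trunc.
Proof. exact: measurable_minr. Qed.

Let m_ex s : measurable_fun setT (ex s).
Proof. by apply: measurableT_comp => //; apply: measurable_funM. Qed.

Let ex_le s u : 0 <= s -> `|ex s u| <= expR (s * t).
Proof.
move=> s0; rewrite ger0_norm ?expR_ge0// ler_expR ler_wpM2l//.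
by rewrite ge_min lexx orbT.
Qed.

Let i_ex s : 0 <= s -> L1 (fun w => ex s (Y w)).
Proof.
move=> s0; have := ib (m_ex s) (fun u => ex_le u s0) (integrable_cst P 1).
by apply: eq_integrable => // w _ /=; rewrite mulr1.
Qed.

Let a s : R := E (fun w => ex s (Y w) * Y w).

(** As [t >= 0], [trunc] preserves signs, so [ex s (Y w) * Y w >= Y w], and [Y] has mean 0. *)
Let a_ge0 s : 0 <= s -> 0 <= a s.
Proof.
move=> s0; rewrite -EY0; apply: le_Rintegral => //.
  exact: (ib _ (fun u => ex_le u s0)).
move=> w _; rewrite /ex; have [Y0|/ltW Y0] := leP 0 (Y w).
  by rewrite ler_peMl// -[leLHS]expR0 ler_expR mulr_ge0// /trunc le_min Y0.
rewrite ler_niMl// -[leRHS]expR0 ler_expR mulr_ge0_le0//.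
exact: le_trans (trunc_le _) Y0.
Qed.

Let a_le s : 0 <= s -> (1 - beta * s) * a s <= s * C * m s.
Proof.
move=> s0.
have ic : L1 (fun=> C) by exact: integrable_cst.
have ibY : L1 (fun w => b * Y w) by have := integrableZl measurableT b iY.
have ibYC := integrableD_EFin ibY ic.
have iD2 : L1 (fun w => D w / 2).
  have := integrableZl measurableT 2^-1 iD.
  by apply: eq_integrable => // w _ /=; rewrite mulrC.
(* One constant for both test functions, [ex s] and [(s / 2) ex s], as [stein] requires. *)
have bnd u : `|ex s u| <= (1 + s / 2) * expR (s * t).
  by rewrite (le_trans (ex_le u s0))// ler_peMl ?expR_ge0// lerDl divr_ge0.
have bnd2 u : `|s / 2 * ex s u| <= (1 + s / 2) * expR (s * t).
  have := ex_le u s0; rewrite normrM ger0_norm ?divr_ge0// => h.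
  apply: (@le_trans _ _ (s / 2 * expR (s * t))); first by rewrite ler_wpM2l ?divr_ge0.
  by rewrite ler_wpM2r ?expR_ge0// lerDr.
have m2 : measurable_fun setT (fun u => s / 2 * ex s u) by exact: measurable_funM.
have step1 : a s <= E (fun w => s / 2 * ex s (Y w) * D w).
  apply: (stein (m_ex s) m2 bnd bnd2) => u v.
  apply: (le_trans (ler_dist_expR _ _)).
  rewrite -mulrBr normrM (ger0_norm s0).
  have -> : s / 2 * ex s u + s / 2 * ex s v = (ex s u + ex s v) / 2 * s.
    by field.
  rewrite -[leRHS]mulrA ler_wpM2l// ?divr_ge0 ?addr_ge0 ?expR_ge0//.
  by rewrite ler_wpM2l.
have step2 : E (fun w => s / 2 * ex s (Y w) * D w) <=
    s * E (fun w => ex s (Y w) * (b * Y w + C)).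
  rewrite -RintegralZl//; last exact: (ib _ bnd).
  apply: ae_le_Rintegral.
  - exact: (ib m2 bnd2).
  - by have := integrableZl measurableT s (ib (m_ex s) bnd ibYC).
  - apply: filterS D_le => w Dw.
    have -> : s / 2 * ex s (Y w) * D w = s * (ex s (Y w) * (D w / 2)) by field.
    by rewrite !ler_wpM2l ?expR_ge0.
have step3 : E (fun w => ex s (Y w) * (b * Y w + C)) = b * a s + C * m s.
  transitivity (E (fun w => b * (ex s (Y w) * Y w) + C * ex s (Y w))).
    by apply: eq_Rintegral => w _; ring.
  have iexY : L1 (fun w => ex s (Y w) * Y w) by exact: (ib _ bnd).
  rewrite RintegralD//.
  - by rewrite !RintegralZl//; exact: i_ex.
  - by have := integrableZl measurableT b iexY.
  - by have := integrableZl measurableT C (i_ex s0).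
(* Since [a s >= 0], [b] may be replaced by [beta]. *)
have := le_trans step1 step2; rewrite step3.
have := ler_wpM2r (a_ge0 s0) b_beta; have := ler_wpM2l s0; nra.
Qed.

(** [expR] lies above its tangent at [y * g], so the increment is at most [y - x] times the mean of
    [g * expR (y * g)]; then [g <= Y]. *)
Let m_increment x y : 0 <= x -> x <= y -> m y - m x <= (y - x) * a y.
Proof.
move=> x0 xy; have y0 := le_trans x0 xy.
rewrite -RintegralB//; [|exact: i_ex..].
have iexY : L1 (fun w => ex y (Y w) * Y w) by exact: (ib _ (fun u => ex_le u y0)).
rewrite -RintegralZl//; apply: le_Rintegral => //.
- by have := integrableB measurableT (i_ex y0) (i_ex x0).
- by have := integrableZl measurableT (y - x) iexY.
- move=> w _; rewrite /ex; set g := trunc (Y w).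
  have := expR_ge1Dx ((x - y) * g).
  have -> : expR (x * g) = expR (y * g) * expR ((x - y) * g).
    by rewrite -expRD; congr expR; ring.
  have := expR_gt0 (y * g); set p := expR (y * g); set q := expR _ => p0 pq.
  have := ler_wpM2l (ltW p0) pq.
  have : (y - x) * p * g <= (y - x) * p * Y w.
    by rewrite ler_wpM2l ?trunc_le// mulr_ge0 ?subr_ge0// ltW.
  lra.
Qed.

Lemma stein_tail :
  (P [set w | (t <= Y w)%R] <= (expR (- (t ^+ 2 / (2 * C + 2 * beta * t))))%:E)%E.
Proof.
have Cbt : 0 < C + beta * t by rewrite ltr_wpDr// mulr_ge0.
(* This [z] minimizes [(C + beta t) z^2 / 2 - z t], with value [- t^2 / (2 C + 2 beta t)]. *)
pose z := t / (C + beta * t).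
have z0 : 0 <= z by rewrite divr_ge0// ltW.
have bz : 1 - beta * z = C / (C + beta * t) by rewrite /z; field; rewrite gt_eqF.
have bz0 : 0 < 1 - beta * z by rewrite bz divr_gt0.
have m_ge0 s : 0 <= m s by apply: Rintegral_ge0 => w _; exact: expR_ge0.
have mz : m z <= expR ((C + beta * t) * z ^+ 2 / 2).
  apply: discrete_gronwall => //; first exact: ltW.
    rewrite /m (@eq_Rintegral _ _ _ P setT (fun=> 1)).
      by rewrite Rintegral_cst//= probability_setT mul1r.
    by move=> w _; rewrite /ex mul0r expR0.
  (* For [y <= z], [1 - beta y >= C / (C + beta t)], so [a_le] gives [a y <= (C + beta t) y m y]:
     Gronwall's hypothesis with [K = C + beta t]. *)
  move=> x y x0 xy yz; apply: (le_trans (m_increment x0 xy)).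
  rewrite ler_wpM2l ?subr_ge0//.
  have y0 := le_trans x0 xy; have := a_le y0.
  have : (1 - beta * z) * a y <= (1 - beta * y) * a y.
    by rewrite ler_wpM2r ?a_ge0// lerD2l lerN2 ler_wpM2l.
  move=> /le_trans h /h; rewrite -(ler_pM2l bz0 (a y)) bz => /le_trans; apply.
  rewrite le_eqVlt; apply/orP; left; apply/eqP.
  by field; rewrite gt_eqF.
have mA := measurable_superlevel t.
have i1A : L1 \1_[set w | t <= Y w] by exact: integrable_indic.
have PA : fine (P [set w | t <= Y w]) = E \1_[set w | t <= Y w].
  by rewrite /Rintegral integral_indic// setIT.
have markov : expR (z * t) * fine (P [set w | t <= Y w]) <= m z.
  rewrite PA -RintegralZl//; apply: le_Rintegral => //.
  - by have := integrableZl measurableT (expR (z * t)) i1A.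
  - exact: i_ex.
  - move=> w _; rewrite indicE; have [|_] := boolP (w \in _).
      by rewrite inE/= mulr1 /ex /trunc => tY; rewrite min_r.
    by rewrite mulr0 expR_ge0.
rewrite -[P _]fineK ?fin_num_measure// lee_fin.
rewrite -(ler_pM2l (expR_gt0 (z * t))) -expRD.
apply: (le_trans markov); apply: (le_trans mz); rewrite ler_expR.
rewrite le_eqVlt; apply/orP; left; apply/eqP.
have Cbt2 : 2 * C + 2 * beta * t != 0.
  by rewrite gt_eqF// -mulrA -mulrDr mulr_gt0.
by rewrite /z; field; rewrite Cbt2 gt_eqF.
Qed.
End tail.

(* At [C = 0] the denominator may vanish; the bound is the limit of those for
   [C + e / 2], [e > 0]. *)
Lemma stein_tail_expeR (b beta C t : R) : E Y = 0 -> 0 <= beta -> b <= beta ->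
  0 <= C -> 0 <= t -> {ae P, forall w, D w / 2 <= b * Y w + C} ->
  (P [set w | (t <= Y w)%R] <=
   expeR (- ((t ^+ 2)%:E / (2 * C + 2 * beta * t)%:E)))%E.
Proof.
move=> EY0 beta0 b_beta C0 t0 D_le.
have mA := measurable_superlevel t.
rewrite -[P _]fineK ?fin_num_measure//; apply: ler_expR_div_perturb => //.
- exact: fine_ge0.
- by rewrite addr_ge0 ?mulr_ge0.
- by rewrite -lee_fin fineK ?fin_num_measure// probability_le1.
- move=> e e0; rewrite -lee_fin fineK ?fin_num_measure//.
  have -> : e + (2 * C + 2 * beta * t) = 2 * (C + e / 2) + 2 * beta * t by field.
  apply: (stein_tail EY0 beta0 b_beta _ t0).
    by rewrite ltr_wpDl// divr_gt0.
  apply: filterS D_le => w /le_trans; apply.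
  by rewrite lerD2l lerDl divr_ge0// ltW.
Qed.

(** * Moment bounds by clipping *)

Section moment.
Variable n : nat.
Hypothesis iDn : L1 (fun w => D w ^+ n.+1).

Let clip (M u : R) : R := Num.max (- M) (Num.min u M).

Let clipP (M u : R) : 0 <= M ->
  [\/ u <= - M /\ clip M u = - M, - M <= u <= M /\ clip M u = u |
      M <= u /\ clip M u = M].
Proof.
move=> M0; rewrite /clip; case: (lerP u M) => uM.
  case: (lerP (- M) u) => Mu; first by constructor 2.
  by constructor 1; split => //; exact: ltW.
by constructor 3; split; [exact: ltW|rewrite max_r//; lra].
Qed.

Let clip_norm (M u : R) : 0 <= M -> `|clip M u| <= M.
Proof.
by move=> M0; rewrite ler_norml; case: (clipP u M0) => -[uM ->]; move: uM; lra.
Qed.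

Let clip_dist (M u v : R) : 0 <= M -> `|clip M u - clip M v| <= `|u - v|.
Proof.
move=> M0; have := ler_norm (u - v); have := ler_norm (v - u).
rewrite (distrC v) ler_norml.
by case: (clipP u M0) => -[+ ->]; case: (clipP v M0) => -[+ ->]; lra.
Qed.

Let clip_sqr_le (M u : R) : 0 <= M -> clip M u ^+ 2 <= clip M u * u.
Proof.
by move=> M0; rewrite expr2; case: (clipP u M0) => -[+ ->]; nra.
Qed.

Let clip_id (M u : R) : `|u| <= M -> clip M u = u.
Proof.
by rewrite ler_norml => /andP[Mu uM]; rewrite /clip min_l// max_r.
Qed.

Let clip_mono (M N u : R) : 0 <= M -> M <= N -> `|clip M u| <= `|clip N u|.
Proof.
move=> M0 MN; have N0 := le_trans M0 MN; rewrite ler_norml.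
have := ler_norm (clip N u); have := ler_norm (- clip N u); rewrite normrN.
by case: (clipP u M0) => -[+ ->]; case: (clipP u N0) => -[+ ->]; lra.
Qed.

Let m_clip (M : R) : measurable_fun setT (clip M).
Proof. by apply: measurable_maxr => //; exact: measurable_minr. Qed.

Let clip_sqr_bound (M u : R) : 0 <= M -> clip M u ^+ 2 <= M ^+ 2.
Proof.
move=> M0; rewrite -(real_normK (num_real (clip M u))).
by rewrite lerXn2r ?nnegrE ?clip_norm.
Qed.

Let integrable_clip_pow (M : R) : 0 <= M ->
  L1 (fun w => (clip M (Y w) ^+ 2) ^+ n.+1).
Proof.
move=> M0; have := @ib (fun u => (clip M u ^+ 2) ^+ n.+1) ((M ^+ 2) ^+ n.+1) (cst 1).
have m_pow : measurable_fun setT (fun u => (clip M u ^+ 2) ^+ n.+1).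
  by do 2 apply: measurable_funX.
have pow_le u : `|(clip M u ^+ 2) ^+ n.+1| <= (M ^+ 2) ^+ n.+1.
  rewrite normrX (ger0_norm (sqr_ge0 _)) lerXn2r// ?nnegrE ?sqr_ge0//.
  exact: clip_sqr_bound.
move=> /(_ m_pow pow_le (integrable_cst P 1)).
by apply: eq_integrable => // w _ /=; rewrite mulr1.
Qed.

Lemma stein_moment_clip M : 0 <= M ->
  E (fun w => (clip M (Y w) ^+ 2) ^+ n.+1) <=
  E (fun w => (n.*2.+1%:R / 2 * D w) ^+ n.+1).
Proof.
(* [k] is the factor of [ler_dist_exprn] for the power [2 n + 1]; the test functions are
   [clip^(2n+1)] and [k clip^(2n)]. *)
move=> M0; set k := n.*2.+1%:R / 2 : R.
have k0 : 0 <= k by rewrite divr_ge0.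
pose q u : R := (clip M u ^+ 2) ^+ n.
have mq : measurable_fun setT q by do 2 apply: measurable_funX.
have q_ge0 u : 0 <= q u by rewrite exprn_ge0 ?sqr_ge0.
have q_le u : q u <= (M ^+ 2) ^+ n.
  by rewrite lerXn2r ?nnegrE ?sqr_ge0// clip_sqr_bound.
have qE u : q u = `|clip M u| ^+ n.*2.
  by rewrite -mul2n exprM real_normK ?num_real.
set c := (1 + M + k) * (M ^+ 2) ^+ n.
have M2n : 0 <= (M ^+ 2) ^+ n by rewrite exprn_ge0 ?sqr_ge0.
have phi_le u : `|clip M u * q u| <= c.
  rewrite normrM (ger0_norm (q_ge0 u)).
  apply: (@le_trans _ _ (M * (M ^+ 2) ^+ n)); first by rewrite ler_pM ?clip_norm.
  by rewrite ler_wpM2r//; lra.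
have psi_le u : `|k * q u| <= c.
  rewrite normrM (ger0_norm (q_ge0 u)) (ger0_norm k0).
  apply: (@le_trans _ _ (k * (M ^+ 2) ^+ n)); first by rewrite ler_wpM2l.
  by rewrite ler_wpM2r//; lra.
have mphi : measurable_fun setT (fun u => clip M u * q u).
  exact: measurable_funM.
have mpsi : measurable_fun setT (fun u => k * q u) by exact: measurable_funM.
have key : E (fun w => clip M (Y w) * q (Y w) * Y w) <=
    E (fun w => k * q (Y w) * D w).
  apply: (stein mphi mpsi phi_le psi_le) => u v.
  have powE x : clip M x * q x = clip M x ^+ n.*2.+1.
    by rewrite exprS -mul2n exprM.
  rewrite !powE -mulrDr !qE; apply: (le_trans (ler_dist_exprn _ _ _)).
  apply: ler_wpM2l; last exact: clip_dist.
  by rewrite mulr_ge0// addr_ge0// exprn_ge0.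
have iA := integrable_clip_pow M0.
have iB : L1 (fun w => (k * D w) ^+ n.+1).
  have := integrableZl measurableT (k ^+ n.+1) iDn.
  by apply: eq_integrable => // w _; rewrite /= -EFinM -exprMn.
have inA : L1 (fun w => n%:R * (clip M (Y w) ^+ 2) ^+ n.+1).
  by have := integrableZl measurableT n%:R iA.
have iqD : L1 (fun w => k * q (Y w) * D w) by exact: (ib mpsi psi_le).
have lower : E (fun w => (clip M (Y w) ^+ 2) ^+ n.+1) <=
    E (fun w => clip M (Y w) * q (Y w) * Y w).
  apply: le_Rintegral => //; first exact: (ib mphi phi_le).
  move=> w _; rewrite [leLHS]exprS -/(q (Y w)) [leRHS]mulrAC.
  apply: ler_wpM2r; [exact: q_ge0|exact: clip_sqr_le].
(* Young's inequality with [a = clip^2] and [s = k D]. *)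
have upper : n.+1%:R * E (fun w => k * q (Y w) * D w) <=
    n%:R * E (fun w => (clip M (Y w) ^+ 2) ^+ n.+1) +
    E (fun w => (k * D w) ^+ n.+1).
  rewrite -!RintegralZl// -RintegralD//; apply: le_Rintegral => //.
  - by have := integrableZl measurableT n.+1%:R iqD.
  - exact: integrableD_EFin.
  - move=> w _; rewrite (mulrC k) -(mulrA (q _)); apply: young_exprn.
      exact: sqr_ge0.
    exact: mulr_ge0.
(* Of the [n + 1] copies of the clipped moment, [n] cancel; clipping makes this moment finite. *)
rewrite -(lerD2l (n%:R * E (fun w => (clip M (Y w) ^+ 2) ^+ n.+1))).
apply: le_trans upper; rewrite -[X in _ + X <= _]mul1r -mulrDl natr1.
by rewrite ler_wpM2l//; exact: le_trans lower key.
Qed.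

Lemma stein_moment : (\int[P]_w ((Y w ^+ 2) ^+ n.+1)%:E <=
  \int[P]_w ((n.*2.+1%:R / 2 * D w) ^+ n.+1)%:E)%E.
Proof.
have iB : L1 (fun w => (n.*2.+1%:R / 2 * D w) ^+ n.+1).
  have := integrableZl measurableT ((n.*2.+1%:R / 2) ^+ n.+1) iDn.
  by apply: eq_integrable => // w _; rewrite /= -EFinM -exprMn.
(* The integrand increases with the clipping level and is eventually unclipped at each [w], so
   monotone convergence applies. *)
pose g (j : nat) (w : Omega) : \bar R := ((clip j%:R (Y w) ^+ 2) ^+ n.+1)%:E.
have g_lim w : limn (g ^~ w) = ((Y w ^+ 2) ^+ n.+1)%:E.
  apply: cvg_lim => //; apply: cvg_near_cst.
  exists (Num.truncn `|Y w|).+1 => // j /= jY; rewrite /g clip_id//.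
  by rewrite (le_trans (ltW (truncnS_gt _)))// ler_nat.
have mg j : measurable_fun setT (g j).
  exact: measurable_int (integrable_clip_pow (ler0n R j)).
have g_ge0 j w : (0 <= g j w)%E by rewrite lee_fin exprn_ge0 ?sqr_ge0.
have g_nd w i j : (i <= j)%N -> (g i w <= g j w)%E.
  move=> ij; rewrite lee_fin lerXn2r ?nnegrE ?sqr_ge0//.
  rewrite -(real_normK (num_real (clip i%:R _))).
  rewrite -(real_normK (num_real (clip j%:R _))).
  by rewrite lerXn2r ?nnegrE// clip_mono ?ler_nat.
under eq_integral do rewrite -g_lim.
rewrite monotone_convergence//; last by move=> w _ i j; exact: g_nd.
apply: lime_le.
  apply: ereal_nondecreasing_is_cvgn => i j ij; apply: ge0_le_integral => //.
  by move=> w _; exact: g_nd.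
apply: nearW => j.
rewrite -[leRHS]fineK ?integrable_fin_num// -[leLHS]fineK; last first.
  exact: integrable_fin_num (integrable_clip_pow (ler0n R j)).
by rewrite lee_fin; exact: stein_moment_clip.
Qed.

End moment.
End stein_inequality.

(** * A real nonnegative version of the conditional expectation *)

Lemma condexp_ge0_version {d d'} {Omega : measurableType d}
    {S : measurableType d'} {R : realType} (P : probability Omega R)
    (X : {mfun Omega >-> S}) (W : Omega -> R) (G : S -> \bar R) :
  P.-integrable setT (EFin \o W) -> (forall w, 0 <= W w) ->
  is_condexp P X (fun w => (W w)%:E) G ->
  exists D : S -> R, [/\ measurable_fun setT D, forall x, 0 <= D x,
    P.-integrable setT (fun w => (D (X w))%:E),
    {ae P, forall w, G (X w) = (D (X w))%:E} &
    forall A, measurable A -> (\int[P]_(w in X @^-1` A) (D (X w))%:E =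
      \int[P]_(w in X @^-1` A) (W w)%:E)%E].
Proof.
move=> iW W0 [mG condG].
have mGX : measurable_fun setT (fun w => G (X w)) by exact: measurableT_comp.
pose neg := [set x | (G x < 0)%E].
have mneg : measurable neg.
  by have := emeasurable_fun_infty_o measurableT mG 0%E; rewrite setTI.
have mN : measurable (X @^-1` neg) by exact: measurable_funPTI.
(* Over this set the absolute value of [G (X)] integrates to minus the integral of [W], hence to at
   most 0. *)
have intN0 : (\int[P]_(w in X @^-1` neg) `|G (X w)| = 0)%E.
  apply/eqP; rewrite eq_le integral_ge0// andbT -oppe_ge0 -integral_ge0N//.
  rewrite (_ : integral _ _ _ = \int[P]_(w in X @^-1` neg) G (X w))%E.
    by rewrite condG//; apply: integral_ge0 => w _; rewrite lee_fin.
  apply: eq_integral => w; rewrite inE => Gw.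
  by rewrite lte0_abs// oppeK.
have G_ge0 : {ae P, forall w, (0 <= G (X w))%E}.
  have /(ae_eq_integral_abs _ mN _) := intN0.
  move=> /(_ (measurable_funTS mGX)); apply: filterS => w h.
  rewrite leNgt; apply/negP => Gw; move: (Gw); rewrite h ?ltxx//.
(* Finiteness of this integral makes [G (X)] finite almost surely, so that [fine] loses nothing. *)
have absG : (\int[P]_w `|G (X w)| = \int[P]_w (W w)%:E)%E.
  transitivity (\int[P]_w G (X w))%E; last first.
    by have := condG setT measurableT; rewrite preimage_setT.
  apply: ae_eq_integral => //; first exact: measurableT_comp.
  by apply: filterS G_ge0 => w G0 _; rewrite gee0_abs.
have iG : P.-integrable setT (fun w => G (X w)).
  by apply/integrableP; split => //; rewrite absG integrable_lty.
pose D x := fine (maxe (G x) 0).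
have mD : measurable_fun setT D.
  by apply: measurableT_comp => //; exact: measurable_maxe.
have mDX : measurable_fun setT (fun w => (D (X w))%:E).
  by apply/measurable_EFinP; exact: measurableT_comp.
have D0 x : 0 <= D x by rewrite fine_ge0// le_max lexx orbT.
have GD : {ae P, forall w, G (X w) = (D (X w))%:E}.
  apply: filterS2 G_ge0 (integrable_ae measurableT iG) => w G0 /(_ I) Gfin.
  by rewrite /D max_l ?fineK.
exists D; split => //.
- apply/integrableP; split => //.
  have -> : (\int[P]_w `|(D (X w))%:E| = \int[P]_w `|G (X w)|)%E.
    apply: ae_eq_integral; [by []|exact: measurableT_comp..|].
    by apply: filterS GD => w -> _.
  by rewrite absG integrable_lty.
- move=> A mA; rewrite -condG//.
  have mXA : measurable (X @^-1` A) by exact: measurable_funPTI.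
  apply: ae_eq_integral; [by []|exact: measurable_funTS|exact: measurable_funTS|].
  by apply: filterS GD => w -> _.
Qed.

Lemma emeasurable_funX {d} {T : measurableType d} {R : realType}
    (A : set T) (g : T -> \bar R) n :
  measurable_fun A g -> measurable_fun A (fun x => g x ^+ n)%E.
Proof.
move=> mg; elim: n => [|n ih]; first exact: measurable_cst.
by under eq_fun do rewrite expeS; exact: emeasurable_funM.
Qed.

Local Open Scope ereal_scope.
(* In (ii) the quotient is taken in the extended reals, where
   x / 0 = +oo for 0 < x, 0 / 0 = 0 and expeR (-oo) = 0. Thus, when the
   denominator vanishes, the bound is 0 for t > 0 and 1 for t = 0. *)
Theorem theorem1p5 (R : realType) (T : pmetricType R) (hT : separable_space T)
  (d : measure_display) (Omega : measurableType d) (P : probability Omega R)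
  (X X' : {RV P >-> borel T}) (hXX' : exchangeable P X X')
  (f : borel T -> R) (F : borel T * borel T -> R)
  (hf : square_integrable P X f)
  (hF : square_integrable P (fun w => (X w, X' w)) F)
  (hanti : {ae P, forall w, F (X w, X' w) = (- F (X' w, X w))%R})
  (hcond : is_condexp P X (fun w => (F (X w, X' w))%:E) (fun x => (f x)%:E))
  (G : borel T -> \bar R)
  (hG : is_condexp P X
          (fun w => (`|(f (X w) - f (X' w)) * F (X w, X' w)|%R)%:E) G) :
  let Delta := fun x : borel T => (2^-1)%:E * G x in
  'E_P[fun w => f (X w)] = 0 /\
  [/\ (\int[P]_w Delta (X w) < +oo ->
       'V_P[fun w => f (X w)] =
         (2^-1)%:E * 'E_P[fun w => ((f (X w) - f (X' w)) * F (X w, X' w))%R]),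
      ((forall theta : R,
          'E_P[fun w => (expR (theta * f (X w)) * `|F (X w, X' w)|)%R] < +oo) ->
       forall B C : R, (0 <= B)%R -> (0 <= C)%R ->
       {ae P, forall w, Delta (X w) <= (B * f (X w) + C)%:E} ->
       forall t : R, (0 <= t)%R ->
         P [set w | (t <= f (X w))%R] <=
           expeR (- ((t ^+ 2)%:E / (2 * C + 2 * B * t)%:E)) /\
         P [set w | (f (X w) <= - t)%R] <=
           expeR (- ((t ^+ 2)%:E / (2 * C)%:E))) &
      (forall k : nat, (0 < k)%N ->
         'E_P[fun w => (f (X w) ^+ (2 * k))%R] <=
           (((2 * k - 1)%:R ^+ k)%R : R)%:E * \int[P]_w (Delta (X w) ^+ k))].
Proof.
move=> Delta.
case: hf hF => mf Ef2 [mF EF2].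
have mfX : measurable_fun setT (fun w => f (X w)) by exact: measurableT_comp.
have mFX : measurable_fun setT (fun w => F (X w, X' w)).
  by apply: measurableT_comp => //; exact: measurable_fun_pair.
have if2 := integrable_expectation_sqr mfX Ef2.
have iF2 := integrable_expectation_sqr mFX EF2.
have condf := hcond.2.
have iff := integrable_stein_product hXX' mf mF if2 iF2.
(* [D] is a real version of [2 Delta]. *)
have [D [mD D0 iD GD condD]] :=
  condexp_ge0_version (integrable_norm iff) (fun=> normr_ge0 _) hG.
have if1 := integrable_of_sqr mfX if2.
have Ef0 := Rintegral_stein0 hXX' mf mF if2 iF2 hanti condf.
have bound := stein_bound hXX' mf mF if2 iF2 hanti condf iD condD.
have EE0 : 'E_P[fun w => f (X w)] = 0.
  by rewrite unlock -[LHS]fineK ?integrable_fin_num// [fine _]Ef0.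
have DeltaD : {ae P, forall w, Delta (X w) = (D (X w) / 2)%:E}.
  by apply: filterS GD => w GDw; rewrite /Delta GDw -EFinM mulrC.
have stein : stein_dominated P (fun w => f (X w)) (fun w => D (X w)).
  move=> phi psi c mphi mpsi phic psic phipsi.
  apply: (bound (phi \o f) (psi \o f) c) => // [||x|x|x y]; last exact: phipsi.
  - exact: measurableT_comp.
  - exact: measurableT_comp.
  - exact: phic.
  - exact: psic.
split=> //; split.
- move=> _.
  have -> : 'V_P[fun w => f (X w)] = \int[P]_w (f (X w) ^+ 2)%:E.
    rewrite /variance covariance.unlock EE0 [in LHS]unlock.
    apply: eq_integral => w _; congr EFin.
    by rewrite expr2 -[in RHS](subr0 (f (X w))).
  rewrite unlock -[LHS]fineK ?integrable_fin_num//.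
  rewrite -[X in _ * X]fineK ?integrable_fin_num// -EFinM; congr EFin.
  have := stein_variance hXX' mf mF if2 iF2 hanti condf; rewrite /Rintegral => <-.
  by rewrite mulrA mulVf// mul1r.
- move=> _ B C B0 C0 DBC t t0.
  have D_le : {ae P, forall w, (D (X w) / 2 <= B * f (X w) + C)%R}.
    by apply: filterS2 DBC DeltaD => w; rewrite -lee_fin => + <-.
  split.
    exact: (stein_tail_expeR if1 iD stein Ef0 B0 (lexx B) C0 t0 D_le).
  have -> : [set w | (f (X w) <= - t)%R] = [set w | (t <= - f (X w))%R].
    by apply/funext => w /=; rewrite lerNr.
  (* Puts the denominator in the form [2 C + 2 beta t] with [beta = 0]. *)
  have -> : (2 * C = 2 * C + 2 * 0 * t)%R by rewrite mulr0 mul0r addr0.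
  have iN : P.-integrable setT (EFin \o (fun w => - f (X w))%R).
    by have := integrableN if1.
  have EN0 : (\int[P]_w - f (X w))%R = 0%R.
    under eq_Rintegral do rewrite -mulN1r.
    by rewrite RintegralZl// Ef0 mulr0.
  (* As [B f + C = (- B) (- f) + C], the slope for [- f] is [b = - B <= 0 = beta]. *)
  apply: (stein_tail_expeR iN iD (stein_dominatedN stein) EN0
    (lexx 0%R) (b := (- B)%R)) => //; first by rewrite oppr_le0.
  by apply: filterS D_le => w; rewrite mulrNN.
- case=> [//|n] _.
  have -> : (2 * n.+1 - 1)%N = n.*2.+1 by rewrite mul2n doubleS subn1.
  set c := n.*2.+1%:R : R.
  have mhalf : measurable_fun setT (fun w => ((D (X w) / 2) ^+ n.+1)%R).
    apply: measurable_funX; apply: measurable_funM => //.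
    exact: measurableT_comp.
  have -> : \int[P]_w Delta (X w) ^+ n.+1 = \int[P]_w ((D (X w) / 2) ^+ n.+1)%:E.
    apply: ae_eq_integral => //.
    - apply: emeasurable_funX; apply: measurable_funeM.
      exact: measurableT_comp hG.1 _.
    - exact/measurable_EFinP.
    - by apply: filterS DeltaD => w -> _; rewrite EFin_expe.
  have D2_ge0 w : (0 <= (D (X w) / 2) ^+ n.+1)%R by rewrite exprn_ge0// divr_ge0.
  (* If the moment of [Delta] is infinite, so is the right side, its constant being positive. *)
  have [Doo|] := ltP (\int[P]_w ((D (X w) / 2) ^+ n.+1)%:E) +oo; last first.
    by rewrite leye_eq => /eqP ->; rewrite gt0_muley ?leey// lte_fin exprn_gt0.
  have i2 : P.-integrable setT (EFin \o (fun w => (D (X w) / 2) ^+ n.+1)%R).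
    apply/integrableP; split; first exact/measurable_EFinP.
    by under eq_integral do rewrite /= ger0_norm//.
  have iDn : P.-integrable setT (EFin \o (fun w => D (X w) ^+ n.+1)%R).
    have := integrableZl measurableT (2 ^+ n.+1)%R i2.
    apply: eq_integrable => // w _ /=; rewrite -EFinM -exprMn.
    by rewrite mulrCA divff// mulr1.
  rewrite unlock -integralZl//.
  have -> : \int[P]_w (f (X w) ^+ (2 * n.+1))%:E =
      \int[P]_w ((f (X w) ^+ 2) ^+ n.+1)%:E.
    by apply: eq_integral => w _; rewrite exprM.
  apply: (le_trans (stein_moment if1 iD (fun w => D0 (X w)) stein iDn)).
  rewrite le_eqVlt; apply/orP; left; apply/eqP; apply: eq_integral => w _.
  by rewrite -EFinM -exprMn mulrAC mulrA.
Qed.
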